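(* Let $k\ge2$ and $n\ge 1$, and let $T$ be a $\mathbb{Z}_+^k$-action on the torus $\mathbb{T}^n=\mathbb{R}^n/\mathbb{Z}^n$ whose generators $T_i=A_i$ $(1\le i\le k)$ are pairwise different, where each $A_i$ is the endomorphism of $\mathbb{T}^n$ induced by an $n\times n$ integer matrix, also denoted $A_i$. Suppose that all the matrices $A_i$ are non-singular and that, for every $i$, all eigenvalues of $A_i$ have modulus greater than $1$. Then $$h(T)\le\log\Bigl(\sum_{i=1}^{k}\prod_{j=1}^{n}|\lambda_i^{(j)}|\Bigr),$$ where $\lambda_i^{(1)},\dots,\lambda_i^{(n)}$ are the (complex) eigenvalues of $A_i$, counted with their multiplicities.
   Context: $\mathbb{Z}_+=\{0,1,2,\dots\}$. For a compact metric space $(X,d_X)$, $C^0(X,X)$ is the set of continuous maps $X\to X$. A continuous $\mathbb{Z}_+^k$-action on $X$ is a monoid homomorphism $T:\mathbb{Z}_+^k\to C^0(X,X)$; its generators are the (commuting) maps $T_i=T(0,\dots,0,1,0,\dots,0)$ with $1$ in the $i$-th place, $1\le i\le k$. Here $X=\mathbb{T}^n$ (with its standard flat metric). Friedland's entropy: the orbit space of $T$ is $$X_T=\Bigl\{\{x_m\}_{m\in\mathbb{Z}_+}\in\prod_{m\in\mathbb{Z}_+}X:\ \text{for every } m\in\mathbb{Z}_+ \text{ there is } i_m\in\{1,\dots,k\} \text{ with } T_{i_m}(x_m)=x_{m+1}\Bigr\},$$ a compact space with metric $d_{X_T}(\bar x,\bar y)=\sum_{m=0}^\infty 2^{-m}d_X(x_m,y_m)$.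 The shift $\sigma_T:X_T\to X_T$ is $\sigma_T(\{x_m\}_m)=\{x_{m+1}\}_m$. The entropy of the action is $h(T):=h(\sigma_T)$, the usual topological entropy of the continuous map $\sigma_T$, i.e. $h(T)=\lim_{\varepsilon\to0}\limsup_{m\to\infty}\frac1m\log s(m,\varepsilon)$, where $s(m,\varepsilon)$ is the largest cardinality of a set $F\subset X_T$ such that $\max_{0\le i\le m-1}d_{X_T}(\sigma_T^i\bar x,\sigma_T^i\bar y)>\varepsilon$ for all distinct $\bar x,\bar y\in F$. *)

(* Defs.v *)
From HB Require Import structures.
From mathcomp Require Import all_boot all_order all_algebra.
From mathcomp Require Import generic_quotient ring_quotient complex.
From mathcomp Require Import all_classical all_reals all_analysis.
From mathcomp Require Import ring.

Set Implicit Arguments.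
Unset Strict Implicit.
Unset Printing Implicit Defensive.

Import Order.TTheory GRing.Theory Num.Theory.
Import numFieldTopology.Exports.

Local Open Scope classical_set_scope.
Local Open Scope ring_scope.
Local Open Scope quotient_scope.

Section EuclideanNorm.
Variables (R : realType) (n : nat).
Implicit Types u v : 'cV[R]_n.

Definition enorm v : R := Num.sqrt (\sum_i v i 0 ^+ 2).

Let dot u v := \sum_i u i 0 * v i 0.

Let enormE v : enorm v = Num.sqrt (dot v v).
Proof. by []. Qed.

Let dot_ge0 v : 0 <= dot v v.
Proof. by apply: sumr_ge0 => i _; rewrite -expr2 sqr_ge0. Qed.

Lemma enorm_ge0 v : 0 <= enorm v.
Proof. exact: sqrtr_ge0. Qed.

Lemma enorm0 : enorm 0 = 0.
Proof. by rewrite /enorm big1 ?sqrtr0// => i _; rewrite mxE expr0n. Qed.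

Lemma enormN v : enorm (- v) = enorm v.
Proof. by congr Num.sqrt; apply: eq_bigr => i _; rewrite mxE sqrrN. Qed.

Lemma ler_coord_enorm v i : `|v i 0| <= enorm v.
Proof.
rewrite -sqrtr_sqr ler_sqrt; last exact: dot_ge0.
by rewrite (bigD1 i)//= lerDl sumr_ge0// => j _; rewrite sqr_ge0.
Qed.

Let cauchy_schwarz u v : dot u v ^+ 2 <= dot u u * dot v v.
Proof.
rewrite -subr_ge0 -(@pmulr_rge0 _ 2)//.
suff -> : 2 * (dot u u * dot v v - dot u v ^+ 2) =
    \sum_i \sum_j (u i 0 * v j 0 - u j 0 * v i 0) ^+ 2.
  by apply: sumr_ge0 => i _; apply: sumr_ge0 => j _; exact: sqr_ge0.
have dM (a b c d : 'cV[R]_n) : dot a b * dot c d =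
    \sum_i \sum_j (a i 0 * b i 0) * (c j 0 * d j 0).
  by rewrite /dot big_distrl/=; apply: eq_bigr => i _; rewrite big_distrr.
have dM' : dot u u * dot v v = dot v v * dot u u by rewrite mulrC.
rewrite mulrBr mulr_natl mulr2n {2}dM' expr2 !dM mulr_natl mulr2n.
rewrite -!big_split -sumrB /=; apply: eq_bigr => i _.
rewrite -!big_split -sumrB /=; apply: eq_bigr => j _.
by ring.
Qed.

Lemma ler_enormD u v : enorm (u + v) <= enorm u + enorm v.
Proof.
rewrite -(@ler_pXn2r _ 2)// ?nnegrE ?addr_ge0 ?enorm_ge0//.
rewrite sqrrD !enormE !sqr_sqrtr ?dot_ge0// -sqrtrM ?dot_ge0//.
have -> : dot (u + v) (u + v) = dot u u + dot u v *+ 2 + dot v v.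
  rewrite /dot -sumrMnl -!big_split/=; apply: eq_bigr => i _.
  by rewrite !mxE; ring.
rewrite lerD2r lerD2l lerMn2r/=.
apply: (le_trans (ler_norm _)); rewrite -sqrtr_sqr ler_sqrt ?cauchy_schwarz//.
by rewrite mulr_ge0 ?dot_ge0.
Qed.

End EuclideanNorm.

Section Torus.
Variables (R : realType) (n : nat).

Definition int_lattice : {pred 'cV[R]_n} :=
  [pred v : 'cV[R]_n | [forall i, v i 0 \is a Num.int]].

Lemma int_lattice_zmod_closed : zmod_closed int_lattice.
Proof.
split=> [|u v /forallP uZ /forallP vZ]; apply/forallP => i; rewrite !mxE.
  exact: rpred0.
exact: rpredB.
Qed.
HB.instance Definition _ := GRing.isZmodClosed.Build 'cV[R]_n int_lattice
  int_lattice_zmod_closed.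

Definition torus : Type := Quotient.quot int_lattice.
HB.instance Definition _ := ZmodQuotient.on torus.
HB.instance Definition _ := Choice.on torus.

Lemma torus_eqP (u v : 'cV[R]_n) :
  reflect (\pi_torus u = \pi_torus v) (u - v \in int_lattice).
Proof. by rewrite Quotient.idealrBE; exact: eqP. Qed.

(* The quotient norm: the length of a shortest vector in the class of t. *)
Definition torus_norm (t : torus) : R :=
  inf [set enorm v | v in [set v | \pi_torus v = t]].

Let tset_lb (t : torus) :
  lbound [set enorm v | v in [set v | \pi_torus v = t]] 0.
Proof. by move=> _ [v _ <-]; exact: enorm_ge0. Qed.

Let tset_inf (t : torus) :
  has_inf [set enorm v | v in [set v | \pi_torus v = t]].
Proof.
split; last by exists 0; exact: tset_lb.
by exists (enorm (repr t)); exists (repr t) => //=; rewrite reprK.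
Qed.

Lemma torus_norm_ge0 t : 0 <= torus_norm t.
Proof. by apply: lb_le_inf; [case: (tset_inf t)|exact: tset_lb]. Qed.

Lemma torus_norm_pi v : torus_norm (\pi_torus v) <= enorm v.
Proof.
by apply: ge_inf; [exists 0; exact: tset_lb|exists v].
Qed.

Lemma torus_norm0 : torus_norm 0 = 0.
Proof.
apply/eqP; rewrite eq_le torus_norm_ge0 andbT.
by rewrite -(raddf0 \pi_torus) (le_trans (torus_norm_pi _))// enorm0.
Qed.

Let torus_normN_le t : torus_norm (- t) <= torus_norm t.
Proof.
apply: lb_le_inf; first by case: (tset_inf t).
move=> _ [v /= <- <-]; rewrite -raddfN -enormN.
exact: torus_norm_pi.
Qed.

Lemma torus_normN t : torus_norm (- t) = torus_norm t.
Proof.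
apply/eqP; rewrite eq_le torus_normN_le/=.
by rewrite -{1}(opprK t) torus_normN_le.
Qed.

Lemma ler_torus_normD s t : torus_norm (s + t) <= torus_norm s + torus_norm t.
Proof.
rewrite -lerBlDr; apply: lb_le_inf; first by case: (tset_inf s).
move=> _ [u /= <- <-]; rewrite lerBlDr -lerBlDl.
apply: lb_le_inf; first by case: (tset_inf t).
move=> _ [v /= <- <-]; rewrite lerBlDl -raddfD.
exact: le_trans (torus_norm_pi _) (ler_enormD _ _).
Qed.

Lemma torus_norm0_eq0 t : torus_norm t = 0 -> t = 0.
Proof.
rewrite -(reprK t); set v := repr t => t0.
rewrite -(raddf0 \pi_torus); apply/torus_eqP; rewrite subr0.
apply/forallP => i; apply/negPn/negP => vZ.
pose a := v i 0; pose f : R := (Num.floor a)%:~R.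
have fa : f <= a by exact: floor_le_tmp.
have af : a < f + 1 by rewrite /f -intrD1 floorD1_gt.
have fNa : f != a by apply: contra vZ; rewrite intrEfloor.
have : 0 < torus_norm (\pi_torus v); last by rewrite t0 ltxx.
apply: (@lt_le_trans _ _ (Num.min (a - f) (f + 1 - a))).
  by rewrite lt_min !subr_gt0 af lt_neqAle fNa fa.
apply: lb_le_inf; first by case: (tset_inf (\pi_torus v)).
move=> _ [w /= wv <-]; apply: le_trans (ler_coord_enorm _ i).
have /forallP/(_ i) : w - v \in int_lattice by exact/torus_eqP.
rewrite !mxE => /intrP[m wm].
have -> : w i 0 = a + m%:~R by rewrite -wm /a; ring.
rewrite ge_min; have [m0|m0] := leP 0 (m + Num.floor a).
  apply/orP; left; apply: le_trans (ler_norm _); rewrite lerD2l -/f.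
  by rewrite -subr_ge0 opprK /f -intrD ler0z.
apply/orP; right; rewrite -normrN; apply: le_trans (ler_norm _).
have -> : - (a + m%:~R) = - m%:~R - a by ring.
rewrite lerD2r /f -intrD1 -rmorphN ler_int.
by move: m0; rewrite -lezD1 -addrA addrC -lerBrDr sub0r.
Qed.

Lemma torus_norm_le (t : torus) : torus_norm t <= Num.sqrt n%:R.
Proof.
pose v : 'cV[R]_n := \col_i (repr t i 0 - (Num.floor (repr t i 0))%:~R).
have -> : t = \pi_torus v.
  rewrite -[LHS]reprK; apply/torus_eqP/forallP => i.
  by rewrite !mxE opprB addrC subrK intr_int.
apply: le_trans (torus_norm_pi _) _; rewrite /enorm ler_sqrt ?ler0n//.
apply: (@le_trans _ _ (\sum_(i < n) 1)); last by rewrite sumr_const card_ord.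
apply: ler_sum => i _; rewrite mxE; set a := repr t i 0.
have a0 : 0 <= a - (Num.floor a)%:~R by rewrite subr_ge0 floor_le_tmp.
have a1 : a - (Num.floor a)%:~R <= 1.
  by rewrite lerBlDl ltW// -intrD1 floorD1_gt.
by rewrite expr_le1.
Qed.

(* The flat metric of R^n / Z^n. *)
Let torus_dist (s t : torus) : R := torus_norm (s - t).

Let torus_distxx s : torus_dist s s = 0.
Proof. by rewrite /torus_dist subrr torus_norm0. Qed.

Let torus_dist_eq0 s t : torus_dist s t = 0 -> s = t.
Proof. by move=> /torus_norm0_eq0/eqP; rewrite subr_eq0 => /eqP. Qed.

Let torus_distC s t : torus_dist s t = torus_dist t s.
Proof. by rewrite /torus_dist -opprB torus_normN. Qed.

Let torus_dist_triangle t s u :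
  torus_dist s u <= torus_dist s t + torus_dist t u.
Proof.
rewrite /torus_dist; have -> : s - u = (s - t) + (t - u).
  by rewrite addrA subrK.
exact: ler_torus_normD.
Qed.

HB.instance Definition _ := isMetric.Build R torus
  torus_distxx torus_dist_eq0 torus_distC torus_dist_triangle.

Lemma torus_mdistE (s t : torus) : mdist s t = torus_norm (s - t) :> R.
Proof. by []. Qed.

Definition torus_endo (A : 'M[int]_n) (t : torus) : torus :=
  \pi_torus (map_mx intr A *m repr t).

Lemma torus_endoE (A : 'M[int]_n) (v : 'cV[R]_n) :
  torus_endo A (\pi_torus v) = \pi_torus (map_mx intr A *m v).
Proof.
apply/torus_eqP; rewrite -mulmxBr.
have /torus_eqP/forallP vZ : \pi_torus (repr (\pi_torus v)) = \pi_torus v.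
  by rewrite reprK.
apply/forallP => i; rewrite mxE; apply: rpred_sum => j _.
by rewrite rpredM// mxE intr_int.
Qed.

End Torus.

Section Action.
Variables (k : nat) (X : topologicalType).

(* Z_+^k is the additive monoid {ffun 'I_k -> nat}; an action is a monoid
   homomorphism into (C^0(X, X), \o). *)
Record Zplus_action := Action {
  act :> {ffun 'I_k -> nat} -> X -> X;
  act_continuous : forall a, continuous (act a);
  act0 : act 0 = id;
  actD : forall a b : {ffun 'I_k -> nat}, act (a + b) = act a \o act b }.

Definition generator (T : Zplus_action) (i : 'I_k) : X -> X :=
  T [ffun j => (j == i) : nat].

End Action.

Section TopologicalEntropy.
Variables (R : realType) (Y : Type) (d : Y -> Y -> R) (f : Y -> Y).

(* (m, e)-separated sets; for m > 0 the big maximum of nonnegative reals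
   starting at 0 is the maximum over 0 <= i < m. *)
Definition eps_separated (m : nat) (e : R) (F : set Y) : Prop :=
  forall x y, F x -> F y -> x <> y ->
    e < \big[Num.max/0]_(i < m) d (iter i f x) (iter i f y).

(* s(m, e), as an extended real: it is +oo if there are separated sets of
   arbitrarily large finite cardinality. *)
Definition max_separated (m : nat) (e : R) : \bar R :=
  ereal_sup [set N%:R%:E | N in
    [set N : nat | exists F, (F #= `I_N)%card /\ eps_separated m e F]].

Definition topological_entropy : \bar R :=
  lim (limn_esup (fun m => (m%:R^-1)%:E * lne (max_separated m e))%E
       @[e --> 0^'+]).

End TopologicalEntropy.

Section FriedlandEntropy.
Variables (R : realType) (k : nat) (X : metricType R) (T : Zplus_action k X).

Definition orbit_space : set (nat -> X) :=
  [set x | forall m, exists i, generator T i (x m) = x m.+1].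

Definition orbit_dist (x y : orbit_space) : R :=
  limn (series (fun m => 2^-1 ^+ m * mdist (val x m) (val y m))).

Lemma orbit_space_shift (x : orbit_space) :
  (fun m => val x m.+1) \in orbit_space.
Proof. by apply/mem_set => m; exact: (set_valP x). Qed.

Definition orbit_shift (x : orbit_space) : orbit_space :=
  SigSub (orbit_space_shift x).

Definition friedland_entropy : \bar R :=
  topological_entropy orbit_dist orbit_shift.

End FriedlandEntropy.

(* On the torus the series defining orbit_dist converges. *)
Lemma is_cvg_orbit_dist (R : realType) (k n : nat)
    (T : Zplus_action k (torus R n)) (x y : orbit_space T) :
  cvgn (series (fun m => 2^-1 ^+ m * mdist (val x m) (val y m) : R)).
Proof.
apply: (@series_le_cvg _ _ (geometric (Num.sqrt n%:R) 2^-1)).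
- by move=> m; rewrite mulr_ge0// ?exprn_ge0// mdist_ge0.
- by move=> m; rewrite /= mulr_ge0// ?exprn_ge0// sqrtr_ge0.
- by move=> m; rewrite /= mulrC ler_wpM2r ?exprn_ge0//; exact: torus_norm_le.
- by apply: is_cvg_geometric_series; rewrite ger0_norm// invf_lt1// ltr1n.
Qed.

(* Main.v *)
(* Orbits are coded by finite words. Lift an orbit backwards: starting from a
   lift v_M of x_M in the unit cube, pick lifts v_t of x_t with
   A_{i_t} v_t = v_{t+1} + z, where z runs over representatives of
   Z^n / A_{i_t} Z^n, so that each step costs one of sum_i |det A_i| letters
   (i, z). Two orbits with the same letters have lifts whose difference at
   time t is A_{i_t}^{-1} ... A_{i_{M-1}}^{-1} (v_M - v'_M). The A_i commute and
   the powers of each A_i^{-1} are bounded because its eigenvalues have modulus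
   less than 1, hence such products are uniformly bounded; recording v_M up to
   a fine grid therefore keeps the two orbits close up to time M. This gives
   s(m, e) <= K(e) (sum_i |det A_i|)^m. *)
Require Import Defs.
From mathcomp Require Import all_boot all_order all_algebra.
From mathcomp Require Import generic_quotient complex.
From mathcomp Require Import all_classical all_reals all_analysis.
From mathcomp Require Import ring lra zify.

Set Implicit Arguments.
Unset Strict Implicit.
Unset Printing Implicit Defensive.

Import Order.TTheory GRing.Theory Num.Theory.
Import ComplexField.Normc.
Local Open Scope complex_scope.
Local Open Scope ring_scope.
Local Open Scope quotient_scope.

(** * Boundedness of the inverse powers of expanding integer matrices *)

(** Each step gives [|u t.+1| <= (|u t| + K) / |l|], a contraction with fixed point [K / (|l| - 1)];
    adding [|u 0|] to it yields a bound that every step preserves. *)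
Lemma bounded_recurrence (F : numFieldType) (l K : F) (u v : nat -> F) :
  1 < `|l| -> (forall t, l * u t.+1 = u t - v t) -> (forall t, `|v t| <= K) ->
  exists K', forall t, `|u t| <= K'.
Proof.
move=> l1 uv vK.
have l0 : 0 < `|l| - 1 by rewrite subr_gt0.
have K0 : 0 <= K by apply: le_trans (vK 0%N).
exists (`|u 0%N| + K / (`|l| - 1)); elim=> [|t IH].
  by rewrite lerDl divr_ge0// ltW.
rewrite -(ler_pM2l (lt_trans ltr01 l1)) -normrM uv (le_trans (ler_normB _ _))//.
rewrite (le_trans (lerD IH (vK t)))//.
rewrite -lerBrDl -[X in _ <= _ - X]mul1r -mulrBl mulrDr [_ * (K / _)]mulrC.
by rewrite divfK ?gt_eqF// lerDr mulr_ge0// ltW.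
Qed.

Lemma entrywise_bound (F : numFieldType) n (M : nat -> 'M[F]_n) :
  (forall i j, exists K, forall a, `|M a i j| <= K) ->
  exists K, forall a i j, `|M a i j| <= K.
Proof.
move=> MK; have /choice[K HK] : forall p : 'I_n * 'I_n, exists K,
  forall a, `|M a p.1 p.2| <= K by move=> p; exact: MK.
exists (\sum_p K p) => a i j; apply: (le_trans (HK (i, j) a)).
rewrite (bigD1 (i, j))//= lerDl sumr_ge0// => p _.
exact: le_trans (HK p 0%N).
Qed.

(* Strips the factors A - l of a polynomial in A one at a time: with
   u_a = C B^a and v_a = C (A - l) B^(a+1) one has l u_(a+1) = u_a - v_a. *)
Lemma bounded_expr_of_horner (F : numFieldType) n (A B : 'M[F]_n.+1) (s : seq F) :
  A * B = 1 -> {in s, forall l, 1 < `|l|} -> forall C : 'M[F]_n.+1,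
  (exists K, forall a i j,
     `|(C * horner_mx A (\prod_(l <- s) ('X - l%:P)) * B ^+ a) i j| <= K) ->
  exists K, forall a i j, `|(C * B ^+ a) i j| <= K.
Proof.
move=> AB; elim: s => [|l s IH] s1 C.
  by rewrite big_nil rmorph1 mulr1.
rewrite big_cons rmorphM mulrA => /IH[l' l's|K HK].
  by apply: s1; rewrite inE l's orbT.
apply: entrywise_bound => i j.
apply: (@bounded_recurrence _ l K _
  (fun a => (C * horner_mx A ('X - l%:P) * B ^+ a.+1) i j)) => [|a|a].
- by apply: s1; rewrite mem_head.
- rewrite rmorphB /= horner_mx_X horner_mx_C mulrBr mulrBl exprS.
  rewrite -[C * A * _]mulrA (mulrA A) AB mul1r -exprS.
  have -> : C * l%:M * B ^+ a.+1 = l *: (C * B ^+ a.+1).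
    by rewrite -mul_scalar_mx -!mulmxE mulmxA scalar_mxC.
  by rewrite !mxE opprB addrC subrK.
- exact: HK.
Qed.

(** Over [R[i]] the characteristic polynomial splits into factors ['X - l] with [1 < |l|]. By
    Cayley-Hamilton it kills [A], so the fully multiplied expression is 0; stripping all factors
    leaves the powers of the inverse bounded. *)
Lemma bounded_inv_expr (R : realType) n (A : 'M[int]_n.+1) :
  \det A != 0 ->
  (forall z : R[i], eigenvalue (map_mx intr A) z -> 1 < normc z) ->
  exists K : R, forall a i j, `|(invmx (map_mx intr A) ^+ a) i j| <= K.
Proof.
move=> A0 A1; set Ar := map_mx intr A; pose Ac : 'M[R[i]]_n.+1 := map_mx intr A.
have Acr : Ac = map_mx (real_complex R) Ar.
  by apply/matrixP => i j; rewrite !mxE rmorph_int.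
have Aru : Ar \in unitmx by rewrite unitmxE det_map_mx unitfE intr_eq0.
have AB : Ac * map_mx (real_complex R) (invmx Ar) = 1.
  by rewrite -mulmxE Acr -map_mxM mulmxV// map_mx1.
have [s sE] := closed_field_poly_normal (char_poly Ac).
have s1 : {in s, forall l, 1 < `|l|}.
  move=> l ls; have : 1 < normc l.
    apply: A1; rewrite eigenvalue_root_char -/Ac sE rootZ ?root_prod_XsubC//.
    by rewrite lead_coef_eq0 monic_neq0// char_poly_monic.
  by rewrite -ltcR.
have [|K HK] := bounded_expr_of_horner AB s1 (C := 1).
  exists 0 => a i j.
  have : horner_mx Ac (char_poly Ac) = 0 by exact: Cayley_Hamilton.
  rewrite sE (monicP (char_poly_monic _)) scale1r => ->.
  by rewrite mulr0 mul0r mxE normr0.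
exists (complex.Re K) => a i j.
have := HK a i j; rewrite mul1r -rmorphXn mxE.
have -> : `|real_complex R ((invmx Ar ^+ a) i j)| =
  real_complex R `|(invmx Ar ^+ a) i j| by rewrite normc_def /= expr0n addr0 sqrtr_sqr.
by rewrite lecE => /andP[].
Qed.

(** The point is that [K] does not depend on the exponents [c]: each extra factor multiplies the
    bound by its own uniform bound and by the dimension. *)
Lemma bounded_prod_expr (F : numFieldType) n (I : Type) (B : I -> 'M[F]_n.+1)
    (s : seq I) :
  (forall i, exists K, forall a j l, `|(B i ^+ a) j l| <= K) ->
  exists K, forall (c : I -> nat) j l, `|(\prod_(i <- s) B i ^+ c i) j l| <= K.
Proof.
move=> BK; elim: s => [|i s [K HK]].
  by exists 1 => c j l; rewrite big_nil mxE normr_nat; case: (j == l).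
have [Ki HKi] := BK i; exists (Ki * K *+ n.+1) => c j l.
rewrite big_cons mxE (le_trans (ler_norm_sum _ _ _))//.
apply: (@le_trans _ _ (\sum_(m < n.+1) Ki * K)).
  by apply: ler_sum => m _; rewrite normrM ler_pM.
by rewrite sumr_const card_ord.
Qed.

(** By commutation, the new factor moves to its own place in the product and raises that single
    exponent by one. *)
Lemma mul_prod_expr (A : pzRingType) (I : eqType) (B : I -> A) (s : seq I)
    (c : I -> nat) (i : I) :
  (forall i j, GRing.comm (B i) (B j)) -> uniq s -> i \in s ->
  exists c', B i * \prod_(j <- s) B j ^+ c j = \prod_(j <- s) B j ^+ c' j.
Proof.
move=> BC us si; exists (fun j => (c j + (j == i))%N).
elim: s us si => [//|h s IH] /=/andP[hs us]; rewrite inE !big_cons.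
have [-> _|_ /= si] := eqVneq i h.
  rewrite addn1 exprS mulrA; congr (_ * _).
  rewrite !big_seq; apply: eq_bigr => j js.
  by have [jh|_] := eqVneq j h; [rewrite -jh js in hs|rewrite addn0].
by rewrite addn0 -IH// !mulrA (commrX _ (BC i h)).
Qed.

(** * Residues modulo an integer matrix, and commutation read off from the torus *)

(** Write [A = L D U] in Smith normal form with [L], [U] unimodular. The representatives are [L]
    applied to the integer boxes with sides [|d_i|], and [|det A|] is the product of these sides. *)
Lemma int_mx_residues n (A : 'M[int]_n) : \det A != 0 ->
  exists (I : finType) (z : I -> 'cV[int]_n), #|I| = `|\det A|%N /\
    forall b, exists r c, b = z r + A *m c.
Proof.
have [L Lu [U Uu [d _ AE]]] := int_Smith_normal_form A => A0.
pose D : 'M[int]_n := \matrix_(i, j) (d`_i *+ (i == j :> nat)).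
have DE : D = diag_mx (\row_i d`_i).
  by apply/matrixP => i j; rewrite !mxE val_eqE.
have detE : `|\det A|%N = (\prod_(i < n) `|(d`_i)%R|)%N.
  rewrite AE -/D !det_mulmx !abszM DE det_diag.
  have absz_unit (x : int) : x \is a GRing.unit -> `|x|%N = 1%N.
    by case/orP => /eqP ->.
  rewrite (absz_unit (\det L)) -?unitmxE// (absz_unit (\det U)) -?unitmxE//.
  rewrite mul1n muln1.
  rewrite (big_morph absz abszM (erefl _)).
  by apply: eq_bigr => i _; rewrite mxE.
have d0 (i : 'I_n) : d`_i != 0.
  apply: contra A0 => /eqP di; rewrite -absz_eq0 detE.
  by rewrite (bigD1 i)//= di mul0n.
pose I := {dffun forall i : 'I_n, 'I_(`|(d`_i)%R|%N)}.
exists I; exists (fun r : I => L *m \col_i (r i : nat)%:Z); split.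
  rewrite /I card_dep_ffun detE foldrE big_map big_enum /=.
  by apply: eq_bigr => i _; rewrite card_ord.
move=> b; have [b' ->] : exists b', b = L *m b'.
  by exists (invmx L *m b); rewrite mulKVmx.
have rP (i : 'I_n) : (`|(b' i 0%R %% d`_i)%Z| < `|(d`_i)%R|)%N.
  rewrite -ltz_nat gez0_abs ?modz_ge0// ltz_mod//.
exists (finfun (fun i => Ordinal (rP i)) : I).
exists (invmx U *m \col_i (b' i 0%R %/ d`_i)%Z).
rewrite AE -/D -!mulmxA mulKVmx// -mulmxDr.
congr (_ *m _).
apply/matrixP => i j; rewrite DE mul_diag_mx !mxE ffunE/=.
rewrite ord1 gez0_abs ?modz_ge0// addrC mulrC.
exact: divz_eq.
Qed.

(** The commutator [D] sends every real vector into the lattice. If [D i j] were nonzero, the [j]-th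
    basis vector divided by [2 * D i j] would have an image with [i]-th coordinate 1/2. *)
Lemma torus_endo_commute (R : realType) n (A B : 'M[int]_n) :
  torus_endo A \o torus_endo B = torus_endo B \o torus_endo A :> (torus R n -> _) ->
  A *m B = B *m A.
Proof.
move=> AB; apply/eqP; rewrite -subr_eq0; apply/eqP/matrixP => i j.
rewrite [RHS]mxE; apply/eqP/negPn/negP => d0.
set D := A *m B - B *m A in d0.
pose v : 'cV[R]_n := (2 * (D i j)%:~R)^-1 *: delta_mx j 0.
have /torus_eqP/forallP/(_ i) : \pi_(torus R n) (map_mx intr (A *m B) *m v) =
    \pi_(torus R n) (map_mx intr (B *m A) *m v).
  by rewrite !map_mxM -!mulmxA -!torus_endoE; exact: (congr1 (@^~ _) AB).
rewrite -mulmxBl -map_mxB -/D {}/v; move: (D) d0 => {}D d0.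
rewrite -scalemxAr mxE -colE !mxE => /intrP[m].
have D0 : (D i j)%:~R != 0 :> R by rewrite intr_eq0.
rewrite invfM divfK// => /(congr1 ( *%R 2)).
rewrite divff ?pnatr_eq0// => /eqP.
(* Back in the integers the claim is [1 = 2 * m], impossible by parity. *)
rewrite -[2]/(2%:~R) -[1]/(1%:~R) -intrM eqr_int.
by lia.
Qed.

(** * Norm comparison and the grid on the unit interval *)

Lemma enorm_le_coord (R : realType) n (v : 'cV[R]_n) (c : R) :
  (forall i, `|v i 0| <= c) -> enorm v <= n%:R * c.
Proof.
case: n v => [|n] v vc.
  by rewrite /enorm big_ord0 sqrtr0 mul0r.
have c0 : 0 <= c by apply: le_trans (vc ord0).
have nc0 : 0 <= n.+1%:R * c by rewrite mulr_ge0.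
rewrite -(ger0_norm nc0) -sqrtr_sqr ler_sqrt ?sqr_ge0//.
apply: (@le_trans _ _ (\sum_(i < n.+1) c ^+ 2)).
  by apply: ler_sum => i _; rewrite -real_normK ?num_real// lerXn2r ?nnegrE.
rewrite sumr_const card_ord -[leLHS]mulr_natl exprMn ler_wpM2r ?sqr_ge0//.
by rewrite -natrX ler_nat leq_pmulr.
Qed.

Lemma exists_box (R : realType) N (a : R) : 0 <= a < 1 ->
  exists j : 'I_N.+1, j%:R <= N.+1%:R * a < j.+1%:R.
Proof.
move=> /andP[a0 a1]; have Na0 : 0 <= N.+1%:R * a by rewrite mulr_ge0.
have /andP[ja aj] := Num.Theory.truncn_itv Na0.
have jN : (Num.truncn (N.+1%:R * a) < N.+1)%N.
  by rewrite -(ltr_nat R) (le_lt_trans ja)// -[ltRHS]mulr1 ltr_pM2l.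
by exists (Ordinal jN); rewrite ja.
Qed.

Lemma box_dist (R : realType) N (j : nat) (a b : R) :
  j%:R <= N.+1%:R * a < j.+1%:R -> j%:R <= N.+1%:R * b < j.+1%:R ->
  `|a - b| <= N.+1%:R^-1.
Proof.
rewrite -[j.+1%:R]natr1 => /andP[ja aj] /andP[jb bj].
rewrite -[leRHS]mul1r ler_pdivlMr// -[N.+1%:R]gtr0_norm// -normrM.
by rewrite ler_norml mulrC mulrBr; lra.
Qed.

(** * Lifting and coding of orbits *)

Lemma torus_lift_unit_cube (R : realType) n (x : torus R n) :
  exists2 v, \pi_(torus R n) v = x & forall i, 0 <= v i 0 < 1.
Proof.
exists (\col_i (repr x i 0 - (Num.floor (repr x i 0))%:~R)).
  rewrite -[RHS]reprK; apply/torus_eqP/forallP => i.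
  by rewrite !mxE addrAC subrr sub0r rpredN intr_int.
move=> i; rewrite mxE subr_ge0 floor_le_tmp/= ltrBlDl.
by rewrite -intrD1 floorD1_gt.
Qed.

(* An alphabet with one letter for each pair (i, class of Z^n / A_i Z^n). *)
Lemma lift_alphabet (R : realType) k n (A : 'I_k -> 'M[int]_n) :
  (forall i, \det (A i) != 0) ->
  exists (S : finType) (sym : S -> 'I_k) (z : S -> 'cV[R]_n),
    #|S| = (\sum_i `|\det (A i)|)%N /\
    forall (x : torus R n) i v, \pi_(torus R n) v = torus_endo (A i) x ->
    exists s u, \pi_(torus R n) u = x /\
      map_mx intr (A (sym s)) *m u = v + z s.
Proof.
(* The index type and its representatives are bundled so that both are chosen at once for each
   [i]. *)
move=> A0; have /choice[P HP] : forall i, exists P : {I : finType & I -> 'cV[int]_n},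
    #|tag P| = `|\det (A i)|%N /\
    forall b, exists r c, b = tagged P r + A i *m c.
  by move=> i; have [I [z Iz]] := int_mx_residues (A0 i); exists (Tagged _ z).
exists {i : 'I_k & tag (P i)}; exists (@tag _ _).
exists (fun s => map_mx intr (tagged (P (tag s)) (tagged s))); split.
  rewrite card_tagged sumnE big_map big_enum.
  by apply: eq_bigr => i _; have [->] := HP i.
move=> x i v; rewrite -[x]reprK torus_endoE => /torus_eqP/forallP vx.
have [b bE] : exists b : 'cV[int]_n,
    map_mx intr (A i) *m repr x - v = map_mx intr b.
  have /choice[b bE] : forall j, exists m : int,
      (v - map_mx intr (A i) *m repr x) j 0 = m%:~R.
    by move=> j; have /intrP[m ->] := vx j; exists m.
  exists (\col_j - b j); apply/matrixP => j l; rewrite ord1.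
  by rewrite [RHS]mxE [X in X%:~R]mxE rmorphN /= -bE !mxE opprB.
have [_ /(_ b)[r [c bzc]]] := HP i.
(* Translating the lift by the lattice vector [c] absorbs the part of [b] in the image of [A i];
   only the representative remains. *)
exists (Tagged (fun i => tag (P i)) r), (repr x - map_mx intr c); split.
  apply/torus_eqP/forallP => j; rewrite !mxE addrAC subrr sub0r.
  by rewrite rpredN intr_int.
rewrite /= mulmxBr -[map_mx intr (A i) *m _](subrK v) bE bzc map_mxD map_mxM.
by rewrite addrAC addrK addrC.
Qed.

(** Induction on [M]: lift the shifted orbit first, then solve for one preimage of its initial
    vector and prepend it. The final vector [v M] is thus the one that is chosen freely. *)
Lemma orbit_lift (R : realType) k n (A : 'I_k -> 'M[int]_n) (S : finType)
    (sym : S -> 'I_k) (z : S -> 'cV[R]_n) :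
  (forall (x : torus R n) i v, \pi_(torus R n) v = torus_endo (A i) x ->
    exists s u, \pi_(torus R n) u = x /\
      map_mx intr (A (sym s)) *m u = v + z s) ->
  forall M (x : nat -> torus R n),
  (forall m, exists i, torus_endo (A i) (x m) = x m.+1) ->
  exists (w : nat -> S) (v : nat -> 'cV[R]_n),
    [/\ forall t, (t <= M)%N -> \pi_(torus R n) (v t) = x t,
        forall i, 0 <= v M i 0 < 1 &
        forall t, (t < M)%N ->
          map_mx intr (A (sym (w t))) *m v t = v t.+1 + z (w t)].
Proof.
move=> Sz; elim=> [|M IH] x xT.
  have [v vx v01] := torus_lift_unit_cube (x 0%N).
  have [i xi] := xT 0%N.
  have [s _] := Sz (x 0%N) i (repr (x 1%N)) (etrans (reprK _) (esym xi)).
  (* For [M = 0] no letter is constrained; [s] merely witnesses that the alphabet is inhabited. *)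
  by exists (fun=> s), (fun=> v); split=> // -[].
have [w [v [vx v01 vw]]] := IH (fun m => x m.+1) (fun m => xT m.+1).
have [i xi] := xT 0%N.
have [s [u [ux us]]] := Sz (x 0%N) i (v 0%N) (etrans (vx 0%N isT) (esym xi)).
exists (fun t => if t is t'.+1 then w t' else s).
exists (fun t => if t is t'.+1 then v t' else u).
by split=> // -[|t]//; [exact: vx|exact: vw].
Qed.

(** Subtracting the two relations cancels [z], so going back one time step applies one inverse
    matrix. Commutation sorts the inverses into powers, which makes the uniform bound on such
    products applicable. *)
Lemma lift_diff_prod_inv (R : realType) k n (A : 'I_k -> 'M[int]_n.+1) (M : nat)
    (i : nat -> 'I_k) (z v v' : nat -> 'cV[R]_n.+1) :
  (forall i, \det (A i) != 0) -> (forall i j, A i *m A j = A j *m A i) ->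
  (forall t, (t < M)%N -> map_mx intr (A (i t)) *m v t = v t.+1 + z t) ->
  (forall t, (t < M)%N -> map_mx intr (A (i t)) *m v' t = v' t.+1 + z t) ->
  forall t, (t <= M)%N -> exists c : 'I_k -> nat, v t - v' t =
    (\prod_(j <- enum 'I_k) invmx (map_mx intr (A j)) ^+ c j) *m (v M - v' M).
Proof.
move=> A0 AC vz vz'.
pose B j : 'M[R]_n.+1 := invmx (map_mx intr (A j)).
have Au j : map_mx intr (A j) \in @unitmx R n.+1.
  by rewrite unitmxE det_map_mx unitfE intr_eq0.
have BC a b : GRing.comm (B a) (B b).
  apply: commrV; apply: commr_sym; apply: commrV.
  by rewrite /GRing.comm -!mulmxE -!map_mxM AC.
(* Backward induction in time: [s] counts the steps before [M]. *)
move=> t tM; rewrite -(subKn tM); move: (M - t)%N (leq_subr t M) => s.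
elim: s => [_|s IH sM].
  by exists (fun=> 0%N); rewrite subn0 big1 ?mul1mx.
have [c cE] := IH (ltnW sM).
have [c' c'E] := mul_prod_expr c BC (enum_uniq 'I_k)
  (mem_enum 'I_k (i (M - s.+1)%N)).
exists c'; rewrite -c'E -mulmxE -mulmxA -cE.
have tE : (M - s)%N = (M - s.+1).+1 by rewrite subnSK.
have tM' : (M - s.+1 < M)%N by lia.
rewrite tE -[_ - _](mulKmx (Au (i (M - s.+1)%N))); congr (_ *m _).
by rewrite mulmxBr vz// vz'// opprD addrACA subrr addr0.
Qed.

Lemma generator_comm k (X : topologicalType) (T : Zplus_action k X) i j :
  generator T i \o generator T j = generator T j \o generator T i.
Proof. by rewrite /generator -!actD addrC. Qed.

(** A code is the grid box of [v M] together with the first [M] letters. [C] is independent of [N]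
    and [M], so refining the grid affects only the constant factor in the count. *)
Lemma orbit_codes (R : realType) k n (A : 'I_k -> 'M[int]_n.+1)
    (T : Zplus_action k (torus R n.+1)) :
  (forall i, generator T i = torus_endo (A i)) ->
  (forall i, \det (A i) != 0) ->
  (forall i (z : R[i]), eigenvalue (map_mx intr (A i)) z -> 1 < normc z) ->
  exists2 C : R, 0 <= C & forall N M,
  exists (I : finType) (code : orbit_space T -> I),
    #|I| = (N.+1 ^ n.+1 * (\sum_i `|\det (A i)|) ^ M)%N /\
    forall x y, code x = code y -> forall t, (t <= M)%N ->
      mdist (val x t) (val y t) <= C / N.+1%:R.
Proof.
move=> hT A0 A1.
have AC i j : A i *m A j = A j *m A i.
  by apply: (@torus_endo_commute R); rewrite -!hT generator_comm.
have [K HK] := bounded_prod_expr (enum 'I_k)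
  (fun i => bounded_inv_expr (A0 i) (A1 i)).
have K0 : 0 <= K by apply: le_trans (HK (fun=> 0%N) ord0 ord0).
have [S [sym [z [cardS Sz]]]] := lift_alphabet R A0.
(* One factor [n.+1] comes from the matrix-vector product, the other from bounding the Euclidean
   norm by the coordinates. *)
exists (n.+1%:R * (n.+1%:R * K)); first by rewrite !mulr_ge0.
move=> N M; pose I := ({ffun 'I_n.+1 -> 'I_N.+1} * {ffun 'I_M -> S})%type.
have /choice[code Hcode] : forall x : orbit_space T, exists (p : I) (w : nat -> S) v,
  [/\ forall t, (t <= M)%N -> \pi_(torus R n.+1) (v t) = val x t,
      forall i, (p.1 i)%:R <= N.+1%:R * v M i 0 < (p.1 i).+1%:R,
      p.2 = [ffun t : 'I_M => w t] &
      forall t, (t < M)%N ->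
        map_mx intr (A (sym (w t))) *m v t = v t.+1 + z (w t)].
  move=> x.
  have [m|w [v [vx v01 vw]]] := @orbit_lift R k n.+1 A S sym z Sz M (val x).
    by have [i xi] := set_valP x m; exists i; rewrite -hT.
  have /choice[b Hb] := fun i => exists_box N (v01 i).
  exists ([ffun i => b i], [ffun t : 'I_M => w t]), w, v.
  by split=> //= i; rewrite ffunE.
exists I, code; split.
  by rewrite card_prod !card_ffun !card_ord cardS.
move=> x y xy t tM; have [w [v [vx vb wE vz]]] := Hcode x.
have [w' [v' []]] := Hcode y; rewrite -xy => v'x v'b w'E v'z.
have ww' m : (m < M)%N -> w m = w' m.
  by move=> mM; move: wE; rewrite w'E => /ffunP/(_ (Ordinal mM)); rewrite !ffunE.
have [m mM|c cE] := @lift_diff_prod_inv R k n A M (sym \o w) (z \o w) v v'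
  A0 AC vz _ t tM.
  by rewrite /= ww'// v'z.
rewrite torus_mdistE -vx// -v'x// -raddfB (le_trans (torus_norm_pi _))//.
rewrite cE -2!mulrA; apply: enorm_le_coord => i.
rewrite mxE (le_trans (ler_norm_sum _ _ _))//.
apply: (@le_trans _ _ (\sum_(j < n.+1) K / N.+1%:R)).
  apply: ler_sum => j _; rewrite normrM ler_pM//.
  by rewrite !mxE; exact: box_dist (vb j) (v'b j).
by rewrite sumr_const card_ord mulr_natl.
Qed.

(** * Estimates for the metric of the orbit space *)

Lemma iter_orbit_shift (R : realType) k (X : metricType R) (T : Zplus_action k X)
    (x : orbit_space T) i m :
  val (iter i (@orbit_shift R k X T) x) m = val x (m + i)%N.
Proof. by elim: i m => [|i IH] m; rewrite ?addn0//= IH addSnnS. Qed.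

Lemma sum_halves_le (R : realType) p (a : nat -> R) (c : R) : 0 <= c ->
  (forall m, (m < p)%N -> a m <= c) -> \sum_(m < p) 2^-1 ^+ m * a m <= 2 * c.
Proof.
move=> c0 ac; apply: (@le_trans _ _ (\sum_(m < p) 2^-1 ^+ m * c)).
  by apply: ler_sum => m _; rewrite ler_wpM2l ?exprn_ge0// ac.
rewrite -mulr_suml ler_wpM2r//.
suff -> : \sum_(m < p) (2^-1 : R) ^+ m = 2 - 2 * 2^-1 ^+ p.
  by rewrite gerBl mulr_ge0// exprn_ge0.
elim: p {ac} => [|p IH]; first by rewrite big_ord0 expr0 mulr1 subrr.
by rewrite big_ord_recr/= IH exprS; field.
Qed.

(** The series is cut at [L]: the head is controlled by [c], the tail by the bound [sqrt n] on torus
    distances, and both geometric sums are at most 2. *)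
Lemma orbit_dist_le (R : realType) k n (T : Zplus_action k (torus R n))
    (x y : orbit_space T) (L : nat) (c : R) : 0 <= c ->
  (forall m, (m < L)%N -> mdist (val x m) (val y m) <= c) ->
  orbit_dist x y <= 2 * c + 2^-1 ^+ L * (2 * Num.sqrt n%:R).
Proof.
move=> c0 xyc; apply: limr_le; first exact: is_cvg_orbit_dist.
exists L => // p /= /subnKC <-; rewrite /series/= big_mkord big_split_ord/=.
pose a m : R := mdist (val x m) (val y m).
apply: lerD; first exact: (@sum_halves_le _ _ a).
under eq_bigr do rewrite exprD -mulrA.
rewrite -mulr_sumr ler_wpM2l ?exprn_ge0//.
apply: (@sum_halves_le _ _ (fun m => a (L + m)%N)); first exact: sqrtr_ge0.
by move=> m _; exact: torus_norm_le.
Qed.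

(** * From finite codes to topological entropy *)

(** Pigeonhole: two distinct points of a separated set cannot share a code, so the code is injective
    on it. *)
Lemma max_separated_le_card (R : realType) (Y : Type) (d : Y -> Y -> R)
    (f : Y -> Y) m (e : R) (I : finType) (code : Y -> I) :
  (forall x y, code x = code y ->
    \big[Num.max/0]_(i < m) d (iter i f x) (iter i f y) <= e) ->
  (max_separated d f m e <= (#|I|%:R)%:E)%E.
Proof.
move=> codeP; apply: ge_ereal_sup => _ [N [F [FN sepF]] <-].
pose r x := nat_of_ord (enum_rank (code x)).
have rI : {in F &, injective r}.
  move=> x y /set_mem Fx /set_mem Fy /val_inj/enum_rank_inj xy.
  by apply: contrapT => /(sepF _ _ Fx Fy); rewrite ltNge codeP.
rewrite lee_fin ler_nat -card_le_II -(card_le_eql FN).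
rewrite -(card_le_eql (inj_card_eq rI)); apply: subset_card_le => _ [x _ <-].
exact: ltn_ord.
Qed.

Lemma max_separated_ge0 (R : realType) (Y : Type) (d : Y -> Y -> R)
    (f : Y -> Y) m (e : R) : (0 <= max_separated d f m e)%E.
Proof.
apply: ereal_sup_ubound; exists 0%N => //; exists set0; split=> //.
by rewrite II0.
Qed.

Lemma topological_entropy_le (R : realType) (Y : Type) (d : Y -> Y -> R)
    (f : Y -> Y) (s : R) : 1 <= s ->
  (forall e, 0 < e -> exists2 K : R, 0 < K &
     forall m, (max_separated d f m e <= (K * s ^+ m)%:E)%E) ->
  (topological_entropy d f <= (ln s)%:E)%E.
Proof.
move=> s1 sepK; rewrite /topological_entropy; set g := (X in (X @ _)%classic).
have s0 : 0 < s by exact: lt_le_trans s1.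
have [gc|gNc] := pselect (cvg (g e @[e --> 0^'+]))%classic; last first.
  (* [lim] of a divergent family is the default point [0]. *)
  by rewrite dvgP// lee_fin ln_ge0.
apply: lime_le => //; near=> e.
have e0 : 0 < e by near: e; exact: nbhs_right_gt.
have [K K0 HK] := sepK e e0.
apply/lee_addgt0Pr => r r0.
rewrite /g /limn_esup /limf_esup; apply: ge_ereal_inf.
(* The limsup is an infimum over tails, so one tail suffices; from this [M] on, [ln K / m <= r]. *)
pose M := (Num.truncn (`|ln K| / r)).+1.
exists (ereal_sup [set (m%:R^-1)%:E * lne (max_separated d f m e)
                  | m in [set m | (M <= m)%N]])%E.
  by exists [set m | (M <= m)%N]%classic => //; exists M.
apply: ge_ereal_sup => _ [m /= Mm <-].
have m0 : 0 < m%:R :> R by rewrite ltr0n (leq_trans _ Mm).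
have sm0 : 0 < K * s ^+ m by rewrite mulr_gt0 ?exprn_gt0.
apply: (@le_trans _ _ (m%:R^-1%:E * lne (K * s ^+ m)%:E)%E).
  apply: lee_wpmul2l; first by rewrite lee_fin invr_ge0 ltW.
  rewrite lee_lne ?HK// in_itv/= leey andbT ?max_separated_ge0//.
  by rewrite lee_fin ltW.
rewrite lne_EFin// -EFinM -EFinD lee_fin lnM ?posrE ?exprn_gt0// lnXn//.
rewrite mulrDr -[ln s *+ m]mulr_natl mulKf ?gt_eqF// addrC lerD2l.
rewrite ler_pdivrMl// (le_trans (ler_norm _))// -ler_pdivrMr//.
apply: le_trans (_ : M%:R <= _); last by rewrite ler_nat.
exact/ltW/truncnS_gt.
Unshelve. all: by end_near. Qed.

(** * The entropy bound by determinants and by eigenvalues *)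

Lemma friedland_entropy_le (R : realType) k n (A : 'I_k -> 'M[int]_n.+1)
    (T : Zplus_action k (torus R n.+1)) :
  (0 < k)%N ->
  (forall i, generator T i = torus_endo (A i)) ->
  (forall i, \det (A i) != 0) ->
  (forall i (z : R[i]), eigenvalue (map_mx intr (A i)) z -> 1 < normc z) ->
  (friedland_entropy T <= (ln (\sum_i `|\det (A i)|%N)%:R)%:E)%E.
Proof.
move=> k0 hT A0 A1; set s := (\sum_i _)%N.
have s0 : (0 < s)%N.
  by rewrite /s (bigD1 (Ordinal k0))//= addn_gt0 absz_gt0 A0.
have [C C0 HC] := orbit_codes hT A0 A1.
apply: topological_entropy_le; first by rewrite ler1n.
move=> e e0.
(* The error [e] is split evenly: the grid contributes [2 * (e / 4)] to the orbit distance, and the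
   tail beyond [L] contributes [e / 2]. *)
have [N HN] : exists N, C / N.+1%:R <= e / 4.
  exists (Num.truncn (C / (e / 4))).
  rewrite ler_pdivrMr// mulrC -ler_pdivrMr ?divr_gt0//.
  exact/ltW/truncnS_gt.
have [L HL] : exists L, 2^-1 ^+ L * (2 * Num.sqrt n.+1%:R) <= e / 2.
  set D := 2 * _; have D0 : 0 <= D by rewrite mulr_ge0// sqrtr_ge0.
  exists (Num.truncn (D / (e / 2))); set L := Num.truncn _.
  rewrite exprVn mulrC ler_pdivrMr ?exprn_gt0// mulrC -ler_pdivrMr ?divr_gt0//.
  apply: (@le_trans _ _ L.+1%:R); last by rewrite -natrX ler_nat ltn_expl.
  exact/ltW/truncnS_gt.
(* Comparing [m] shifts with [L] visible coordinates each requires codes up to time [m + L]; the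
   extra factor [s ^ L] is independent of [m]. *)
exists ((N.+1 ^ n.+1 * s ^ L)%N%:R); first by rewrite ltr0n muln_gt0 !expn_gt0 s0.
move=> m; have [I [code [cardI codeP]]] := HC N (m + L)%N.
rewrite -natrX -natrM -mulnA -expnD addnC -cardI.
apply: (@max_separated_le_card _ _ _ _ _ _ _ code) => x y xy.
apply: bigmax_le => [|i _]; first exact: ltW.
apply: le_trans (orbit_dist_le (L := L) (c := C / N.+1%:R) _ _) _.
- by rewrite divr_ge0.
- move=> j jL; rewrite !iter_orbit_shift codeP//.
  by rewrite addnC leq_add// ltnW.
- rewrite (le_trans (lerD (ler_wpM2l _ HN) HL))//.
  by lra.
Qed.

(** Both sides are the modulus of the characteristic polynomial at 0, read once from its roots and
    once as the determinant up to sign. *)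
Lemma prod_normc_eigenvalues (R : realType) n (A : 'M[int]_n)
    (lambda : 'I_n -> R[i]) :
  char_poly (map_mx intr A) = \prod_(j < n) ('X - (lambda j)%:P) ->
  \prod_(j < n) normc (lambda j) = `|\det A|%N%:R.
Proof.
move=> lambdaE; apply: (@complexI R).
rewrite rmorph_prod rmorph_nat natr_absz.
transitivity `|\prod_(j < n) - lambda j|.
  by rewrite normr_prod; apply: eq_bigr => j _; rewrite normrN.
transitivity `|(char_poly (map_mx (intr : int -> R[i]) A)).[0]|.
  rewrite lambdaE horner_prod; congr `|_|; apply: eq_bigr => j _.
  by rewrite !hornerE.
rewrite horner_coef0 char_poly_det det_map_mx normrM normrX normrN1 expr1n mul1r.
by rewrite intr_norm.
Qed.

Theorem theorem4p1 (R : realType) (k n : nat)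
    (hk : (2 <= k)%N) (hn : (1 <= n)%N)
    (A : 'I_k -> 'M[int]_n) (T : Zplus_action k (torus R n))
    (hT : forall i, generator T i = torus_endo (A i))
    (T_diff : injective (generator T))
    (A_nonsing : forall i, \det (A i) != 0)
    (A_eigen : forall (i : 'I_k) (z : R[i]),
       eigenvalue (map_mx intr (A i)) z -> 1 < normc z)
    (lambda : 'I_k -> 'I_n -> R[i])
    (lambdaE : forall i, char_poly (map_mx intr (A i)) =
       \prod_(j < n) ('X - (lambda i j)%:P)) :
  (friedland_entropy T <=
     (ln (\sum_(i < k) \prod_(j < n) normc (lambda i j)))%:E)%E.
Proof.
under eq_bigr do rewrite (prod_normc_eigenvalues (lambdaE _)).
(* The determinant bound is stated in dimension [n.+1]; [hn] excludes dimension 0. *)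
rewrite -natr_sum; case: n hn A T hT {T_diff} A_nonsing A_eigen {lambda lambdaE}.
  by [].
move=> n _ A T hT A0 A1.
exact: friedland_entropy_le (ltnW hk) hT A0 A1.
Qed.
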